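(* The group $G=\mathrm{SL}_2(\mathbb{Z})$ is $\exists$-homogeneous: for every integer $k\geq 1$ and all $k$-tuples $u,v\in G^k$ having the same $\exists$-type, there exists an automorphism $\sigma$ of $G$ such that $\sigma(u)=v$.
   Context: Two $k$-tuples of elements of $G$ have the same $\exists$-type if they satisfy in $G$ the same existential first-order formulas with $k$ free variables in the language of groups (formulas whose only quantifiers are $\exists$; no constants other than $1$). Automorphisms act coordinatewise on tuples. *)

(* Defs.v *)
From HB Require Import structures.
From mathcomp Require Import all_boot all_order all_algebra.

Set Implicit Arguments.
Unset Strict Implicit.
Unset Printing Implicit Defensive.

Import GRing.Theory.

Local Open Scope ring_scope.

Record SL (n : nat) (R : comUnitRingType) : Type := MkSL {
  SLval :> 'M[R]_n;
  SLvalP : \det SLval == 1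
}.

Section SpecialLinearGroup.

Variables (n : nat) (R : comUnitRingType).

Local Notation SL := (SL n R).

HB.instance Definition _ := [isSub for @SLval n R].
HB.instance Definition _ := [Choice of SL by <:].

Implicit Types A B : SL.

Fact SL_one_subproof : \det (1%:M : 'M[R]_n) == 1.
Proof. by rewrite det1. Qed.

Fact SL_mul_subproof A B : \det (SLval A *m SLval B) == 1.
Proof. by rewrite det_mulmx !(eqP (SLvalP _)) mulr1. Qed.

Fact SL_inv_subproof A : \det (invmx (SLval A)) == 1.
Proof. by rewrite det_inv (eqP (SLvalP A)) invr1. Qed.

Definition SL_one : SL := MkSL SL_one_subproof.
Definition SL_mul A B : SL := MkSL (SL_mul_subproof A B).
Definition SL_inv A : SL := MkSL (SL_inv_subproof A).

Fact SL_unitmx A : SLval A \in unitmx.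
Proof. by rewrite unitmxE (eqP (SLvalP A)) unitr1. Qed.

Fact SL_mulA : associative SL_mul.
Proof. by move=> A B C; apply: val_inj; rewrite /= mulmxA. Qed.

Fact SL_mul1 : left_id SL_one SL_mul.
Proof. by move=> A; apply: val_inj; rewrite /= mul1mx. Qed.

Fact SL_mulr1 : right_id SL_one SL_mul.
Proof. by move=> A; apply: val_inj; rewrite /= mulmx1. Qed.

Fact SL_mulV : left_inverse SL_one SL_inv SL_mul.
Proof. by move=> A; apply: val_inj; rewrite /= mulVmx ?SL_unitmx. Qed.

Fact SL_mulrV : right_inverse SL_one SL_inv SL_mul.
Proof. by move=> A; apply: val_inj; rewrite /= mulmxV ?SL_unitmx. Qed.

HB.instance Definition _ :=
  isGroup.Build SL SL_mulA SL_mul1 SL_mulr1 SL_mulV SL_mulrV.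

End SpecialLinearGroup.

Inductive gterm (k : nat) : Type :=
  | TVar of 'I_k
  | TOne
  | TMul of gterm k & gterm k
  | TInv of gterm k.

Arguments TOne {k}.

(* [gformula k]: the first-order formulas in the language of groups whose    *)
(* free variables are among k given ones. A quantifier binds the variable of *)
(* index 0 of its body and shifts the indices of the others by one.          *)
Inductive gformula : nat -> Type :=
  | FEq k of gterm k & gterm k : gformula k
  | FNot k of gformula k : gformula k
  | FAnd k of gformula k & gformula k : gformula k
  | FOr k of gformula k & gformula k : gformula k
  | FImp k of gformula k & gformula k : gformula k
  | FEx k of gformula k.+1 : gformula k
  | FAll k of gformula k.+1 : gformula k.

Fixpoint quantifier_free k (phi : gformula k) : bool :=
  match phi with
  | FEq _ _ _ => true
  | FNot _ phi1 => quantifier_free phi1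
  | FAnd _ phi1 phi2 | FOr _ phi1 phi2 | FImp _ phi1 phi2 =>
      quantifier_free phi1 && quantifier_free phi2
  | FEx _ _ | FAll _ _ => false
  end.

(* Existential formulas are prenex: a block of existential quantifiers,      *)
(* possibly empty, followed by a quantifier-free formula.                    *)
Fixpoint existential k (phi : gformula k) : bool :=
  match phi with
  | FEx _ phi1 => existential phi1
  | phi => quantifier_free phi
  end.

Section Semantics.

Variable G : groupType.

Local Open Scope group_scope.

Fixpoint teval k (e : k.-tuple G) (t : gterm k) : G :=
  match t with
  | TVar i => tnth e i
  | TOne => 1
  | TMul t1 t2 => teval e t1 * teval e t2
  | TInv t1 => (teval e t1)^-1
  end.

Fixpoint satisfies k (phi : gformula k) : k.-tuple G -> Prop :=
  match phi in gformula k return k.-tuple G -> Prop with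
  | FEq _ t1 t2 => fun e => teval e t1 = teval e t2
  | FNot _ phi1 => fun e => ~ satisfies phi1 e
  | FAnd _ phi1 phi2 => fun e => satisfies phi1 e /\ satisfies phi2 e
  | FOr _ phi1 phi2 => fun e => satisfies phi1 e \/ satisfies phi2 e
  | FImp _ phi1 phi2 => fun e => satisfies phi1 e -> satisfies phi2 e
  | FEx _ phi1 => fun e => exists x : G, satisfies phi1 [tuple of x :: e]
  | FAll _ phi1 => fun e => forall x : G, satisfies phi1 [tuple of x :: e]
  end.

Definition same_existential_type k (u v : k.-tuple G) : Prop :=
  forall phi : gformula k, existential phi -> satisfies phi u <-> satisfies phi v.

End Semantics.

(* Main.v *)
From HB Require Import structures.
Require Import Defs.
From mathcomp Require Import all_boot all_order all_algebra.
From mathcomp Require Import zify ring.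

(** The group is generated by a of order 4 and c of order 3, with a^2 = -1. If u
is written as terms t in (a, c), then the formula stating that some x, y satisfy
x^4 = 1, x^2 <> 1, y^3 = 1, y <> 1 and u = t(x, y) is existential, so it holds of
v as well ([existential_transfer]). Elements of order 4 or 3 are conjugate to a^{+-1}
or c^{+-1}, hence up to an automorphism f the pair (x, y) is (a, g^{-1} c g) for some
word g = a c^{+-1} ... a c^{+-1} ([generating_pair_standard]). When g is empty, f
maps u to v.

It remains to exclude a nonempty g. Up to sign, a c and a c^{-1} are the
nonnegative matrices (1 1; 0 1) and (1 0; 1 1), and every element of infinite
order is conjugate, up to sign, to a nonempty product of these two matrices
([gterm_conj_cyclic]). Replacing c by g^{-1} c g inserts further such factors
([word_stretch]), which increases the trace, strictly if g is not empty
([tr_stretch]). So if some term W has a value of infinite order at u, then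
|tr W(u)| <= |tr W(v)|, and by symmetry |tr W(v)| <= |tr W(u)|; equality forces g
to be empty. Traces play here the role of translation lengths on the Bass-Serre
tree.

If no such W exists, u generates a finite group, which is conjugate into <a> or
into <c, -1> ([elliptic_family]). Then t can be chosen as conjugates of powers of
the generators, and on these (x, y) acts like an automorphism, whatever g is. *)

Set Implicit Arguments.
Unset Strict Implicit.
Unset Printing Implicit Defensive.

Import GRing.Theory Num.Theory Order.TTheory.

Local Open Scope group_scope.

Local Notation G := (SL 2 int).

(** * The entries of a two-by-two matrix *)

Definition m11 (A : G) : int := SLval A 0%R 0%R.
Definition m12 (A : G) : int := SLval A 0%R 1%R.
Definition m21 (A : G) : int := SLval A 1%R 0%R.
Definition m22 (A : G) : int := SLval A 1%R 1%R.

Arguments m11 A%_group_scope.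
Arguments m12 A%_group_scope.
Arguments m21 A%_group_scope.
Arguments m22 A%_group_scope.

Lemma SL2P (A B : G) : m11 A = m11 B -> m12 A = m12 B ->
  m21 A = m21 B -> m22 A = m22 B -> A = B.
Proof.
move=> e11 e12 e21 e22; apply/val_inj/matrixP=> i j /=.
have ord2 (l : 'I_2) : l = 0%R \/ l = 1%R.
  by case: l => [[|[|//]] lt_l]; [left | right]; apply: val_inj.
by case: (ord2 i) => ->; case: (ord2 j) => ->.
Qed.

Lemma det2 (M : 'M[int]_2) : (\det M = M 0 0 * M 1 1 - M 0 1 * M 1 0)%R.
Proof.
rewrite (expand_det_row _ 0%R) !big_ord_recl big_ord0 addr0.
rewrite /cofactor !det_mx11 !mxE /= expr0 expr1 mul1r mulrCA mulN1r.
have E (i j : 'I_2) k l : i = k -> j = l -> M i j = M k l by move=> -> ->.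
by congr (_ * _ + - (_ * _))%R; apply: E; apply: val_inj.
Qed.

Lemma detSL2 (A : G) : (m11 A * m22 A - m12 A * m21 A = 1)%R.
Proof. by have /eqP := SLvalP A; rewrite det2. Qed.

Fact mkSL2_subproof (p q r s : int) : (p * s - q * r = 1)%R ->
  (\det (\matrix_(i < 2, j < 2)
     (if i == 0 then if j == 0 then p else q else if j == 0 then r else s)) == 1)%R.
Proof. by move=> h; rewrite det2 !mxE /= h. Qed.

Definition mkSL2 p q r s (h : (p * s - q * r = 1)%R) : G :=
  MkSL (mkSL2_subproof h).

Lemma m_mk p q r s h : (m11 (@mkSL2 p q r s h) = p) * (m12 (mkSL2 h) = q) *
  (m21 (mkSL2 h) = r) * (m22 (mkSL2 h) = s).
Proof. by rewrite /m11 /m12 /m21 /m22 !mxE. Qed.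

Lemma mM (A B : G) :
  (m11 (A * B) = m11 A * m11 B + m12 A * m21 B)%R *
  (m12 (A * B) = m11 A * m12 B + m12 A * m22 B)%R *
  (m21 (A * B) = m21 A * m11 B + m22 A * m21 B)%R *
  (m22 (A * B) = m21 A * m12 B + m22 A * m22 B)%R.
Proof.
rewrite /m11 /m12 /m21 /m22 /=.
have E i j : (SLval A *m SLval B)%R i j = (A i 0 * B 0 j + A i 1 * B 1 j)%R.
  by rewrite !mxE !big_ord_recl big_ord0 addr0; congr (_ * _ + A i _ * B _ j)%R; apply: val_inj.
by rewrite !E.
Qed.

Lemma m1 : (m11 1 = 1%R) * (m12 1 = 0%R) * (m21 1 = 0%R) * (m22 1 = 1%R).
Proof. by rewrite /m11 /m12 /m21 /m22 /= !mxE. Qed.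

Lemma mV (A : G) :
  (m11 A^-1 = m22 A) * (m12 A^-1 = - m12 A)%R *
  (m21 A^-1 = - m21 A)%R * (m22 A^-1 = m11 A).
Proof.
have h : (m22 A * m11 A - (- m12 A) * (- m21 A) = 1)%R by rewrite -(detSL2 A); ring.
suff -> : A^-1 = mkSL2 h by rewrite !m_mk.
apply: mulg1_eq; have := detSL2 A => d.
by apply: SL2P; rewrite !mM !m_mk !m1 -?d; ring.
Qed.

Definition mE := (mM, m1, mV, m_mk).

(** * Generators *)

(** The generators: a has order 4, c has order 3, and z is minus the identity,
the unique involution. The group is the amalgam of <a> and <-c> over <z>. *)
Definition z : G := @mkSL2 (-1) 0 0 (-1) erefl.
Definition a : G := @mkSL2 0 (-1) 1 0 erefl.
Definition c : G := @mkSL2 0 1 (-1) (-1) erefl.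

Ltac sl2 := apply: SL2P; rewrite ?expg2 /z /a /c !mE; ring.

Lemma aa : a * a = z. Proof. by sl2. Qed.
Lemma ccc : c * c * c = 1. Proof. by sl2. Qed.
Lemma zz : z * z = 1. Proof. by sl2. Qed.
Lemma zC (A : G) : z * A = A * z. Proof. by sl2. Qed.

Fact shear_subproof (k : int) : (1 * 1 - k * 0 = 1)%R.
Proof. by rewrite mulr0 subr0. Qed.
Definition shear k : G := mkSL2 (shear_subproof k).

(** The Euclidean algorithm on the first column: a swaps its two entries up to
a sign, and a * c is the elementary matrix that generates the shears. *)
Lemma gen_ac (A : G) : exists t : gterm 2, A = teval [tuple a; c] t.
Proof.
pose P A := exists t : gterm 2, A = teval [tuple a; c] t.
have PM B C : P B -> P C -> P (B * C).
  by move=> [t ->] [t' ->]; exists (TMul t t').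
have PV B : P B -> P B^-1 by move=> [t ->]; exists (TInv t).
have Pa : P a by exists (TVar ord0).
have Pc : P c by exists (TVar (lift ord0 ord0)).
have Pshear_nat (n : nat) : P (shear n).
  elim: n => [|n IH]; first by exists TOne; sl2.
  rewrite (_ : shear n.+1 = a * c * shear n); first by apply: (PM) => //; apply: (PM).
  by apply: SL2P; rewrite /a /c /shear !mE; lia.
have Pshear k : P (shear k).
  case: k => n //; rewrite (_ : shear (Negz n) = (shear n.+1)^-1); first exact: (PV).
  by apply: SL2P; rewrite /shear !mE; lia.
have Pz : P z by rewrite -aa; apply: (PM).
rewrite -/(P A); have [n] := ubnP (absz (m21 A)).
elim: n A => // n IH A; rewrite ltnS => leA.
have dA := detSL2 A.
have [r0|r0] := eqVneq (m21 A) 0%R.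
  rewrite r0 mulr0 subr0 in dA.
  have [ep|en] : m11 A = 1%R \/ m11 A = (-1)%R.
    by move: (dA); rewrite mulrC => /intUnitRing.unitzPl/orP[]/eqP; [left | right].
  - rewrite (_ : A = shear (m12 A)) //.
    by rewrite ep mul1r in dA; apply: SL2P; rewrite /shear !mE //; lia.
  rewrite en mulN1r in dA.
  rewrite (_ : A = z * shear (- m12 A)); first exact: (PM).
  by apply: SL2P; rewrite /z /shear !mE //; lia.
pose q := (m11 A %/ m21 A)%Z.
rewrite (_ : A = shear q * a * (a^-1 * shear (- q) * A)); last by sl2.
apply: (PM); first exact: (PM _ _ (Pshear _)).
apply: IH; apply: leq_trans leA.
have := divz_eq (m11 A) (m21 A); have := modz_ge0 (m11 A) r0.
have := ltz_mod (m11 A) r0; rewrite -/q.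
by rewrite /a /shear !mE => h1 h2 h3; lia.
Qed.

(** * Conjugacy classes of torsion elements *)

(** The trace, up to sign, is the invariant that measures how far a substitution
stretches a conjugacy class. *)
Definition tr (A : G) : int := (m11 A + m22 A)%R.

Arguments tr A%_group_scope.

Lemma trMC A B : tr (A * B) = tr (B * A).
Proof. by rewrite /tr !mE; ring. Qed.

Lemma trJ A g : tr (A ^ g) = tr A.
Proof. by rewrite conjgE trMC mulgK. Qed.

Lemma trz A : tr (z * A) = (- tr A)%R.
Proof. by rewrite /tr /z !mE; ring. Qed.

Lemma round_half (x r : int) : r != 0%R ->
  exists k : int, (`|x - 2 * k * r| <= `|r|)%R.
Proof.
move=> r0; have r2 : (2 * r)%R != 0%R by lia.
exists ((x + `|r|) %/ (2 * r))%Z%R.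
have := divz_eq (x + `|r|)%R (2 * r)%R; have := modz_ge0 (x + `|r|)%R r2.
have := ltz_mod (x + `|r|)%R r2; set k := (_ %/ _)%Z; lia.
Qed.

(** Gauss reduction of the quadratic form attached to A, by descent on the lower
left entry: a shear makes the difference of the diagonal entries small, and a
exchanges the two off-diagonal entries. *)
Lemma conj_reduced (A : G) : (`|tr A| <= 1)%R ->
  exists g, [/\ `|m11 (A ^ g) - m22 (A ^ g)| <= `|m21 (A ^ g)|,
                `|m21 (A ^ g)| <= `|m12 (A ^ g)| & m21 (A ^ g) != 0]%R.
Proof.
have [n] := ubnP (absz (m21 A)).
elim: n A => // n IH A; rewrite ltnS => leA trA.
have r0 (B : G) : (`|tr B| <= 1 -> m21 B != 0)%R.
  by move=> trB; apply/eqP=> r0; have := detSL2 B; move: trB; rewrite /tr r0; nia.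
have [k hk] := round_half (m11 A - m22 A)%R (r0 _ trA).
pose B := A ^ shear k.
have trB : tr B = tr A by rewrite trJ.
have B11 : (m11 B - m22 B = m11 A - m22 A - 2 * k * m21 A)%R.
  by rewrite /B conjgE /shear !mE; ring.
have B21 : m21 B = m21 A by rewrite /B conjgE /shear !mE; ring.
have B0 : m21 B != 0%R by rewrite B21 r0.
have [le|lt] := leP `|m21 B|%R `|m12 B|%R.
  by exists (shear k); rewrite -/B; split=> //; rewrite B11 B21.
have [||g hg] := IH (B ^ a); last by exists (shear k * a * g); rewrite !conjgM.
  by rewrite (_ : m21 (B ^ a) = - m12 B)%R; [lia | rewrite conjgE /a !mE; ring].
by rewrite trJ trB.
Qed.

Lemma int_sq1 (r : int) : (3 * (r * r) <= 4 -> r != 0 -> r = 1 \/ r = -1)%R.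
Proof. by move=> h1 h2; nia. Qed.

(** For a reduced matrix, (m11 - m22)^2 + 4 m12 m21 = tr^2 - 4 forces
3 m21^2 <= 4. *)
Lemma reduced_r (B : G) : (`|tr B| <= 1)%R ->
  (`|m11 B - m22 B| <= `|m21 B|)%R -> (`|m21 B| <= `|m12 B|)%R ->
  m21 B != 0%R -> m21 B = 1%R \/ m21 B = (-1)%R.
Proof.
rewrite /tr => trB le1 le2 r0; apply: int_sq1 r0.
have := detSL2 B; move: trB le1 le2.
move: (m11 B) (m12 B) (m21 B) (m22 B) => p q r s.
move=> t l1 l2 d.
have d4 : (4 * (q * r) = (p + s) * (p + s) - (p - s) * (p - s) - 4)%R by lia.
have l3 : ((p - s) * (p - s) <= r * r)%R by nia.
have l4 : (r * r <= `|q * r|)%R by rewrite normrM; nia.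
have : ((p + s) * (p + s) <= 1)%R by nia.
have : (0 <= (p - s) * (p - s))%R by nia.
lia.
Qed.

Lemma conj_a (A : G) : tr A = 0%R -> exists g, A ^ g = a \/ A ^ g = a^-1.
Proof.
move=> trA; have [|g [h1 h2 h3]] := @conj_reduced A; first by rewrite trA.
have trB : tr (A ^ g) = 0%R by rewrite trJ.
have := reduced_r _ h1 h2 h3; rewrite trB => /(_ isT) hr.
exists g; move: (A ^ g) trB h1 h2 h3 hr => B; rewrite /tr.
have := detSL2 B => d t h1 h2 h3 hr.
have p0 : m11 B = 0%R by lia.
have s0 : m22 B = 0%R by lia.
by case: hr => r0; rewrite p0 s0 r0 in d; [left | right]; apply: SL2P; rewrite /a !mE //; lia.
Qed.

Lemma conj_c (A : G) : tr A = (-1)%R -> exists g, A ^ g = c \/ A ^ g = c^-1.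
Proof.
move=> trA; have [|g [h1 h2 h3]] := @conj_reduced A; first by rewrite trA.
have trB : tr (A ^ g) = (-1)%R by rewrite trJ.
have := reduced_r _ h1 h2 h3; rewrite trB => /(_ isT) hr.
suff [h hh] : exists h, (A ^ g) ^ h = c \/ (A ^ g) ^ h = c^-1.
  by exists (g * h); rewrite conjgM.
move: (A ^ g) trB h1 h2 h3 hr => B; rewrite /tr.
have := detSL2 B => d t h1 h2 h3 hr.
have : (m11 B = 0 /\ m22 B = -1)%R \/ (m11 B = -1 /\ m22 B = 0)%R by lia.
move=> [] [p0 s0]; case: hr => r0; rewrite p0 s0 r0 in d.
- exists (shear 1); right; apply: SL2P; rewrite conjgE /c /shear !mE p0 s0 r0; lia.
- exists 1; left; apply: SL2P; rewrite conjg1 /c !mE //; lia.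
- exists 1; right; apply: SL2P; rewrite conjg1 /c !mE //; lia.
exists (shear 1); left; apply: SL2P; rewrite conjgE /c /shear !mE p0 s0 r0; lia.
Qed.

(** * Elliptic elements *)

(** Equality in PSL(2, Z). Computing modulo z avoids tracking the signs that
appear when a or c is inverted. *)
Definition eqz (A B : G) := A = B \/ A = z * B.

Lemma eqz_refl A : eqz A A. Proof. by left. Qed.

Lemma eqz_trans A B C : eqz A B -> eqz B C -> eqz A C.
Proof.
by move=> [] -> [] ->; rewrite ?mulgA ?zz ?mul1g; [left | right | right | left].
Qed.

Lemma eqzM A A' B B' : eqz A A' -> eqz B B' -> eqz (A * B) (A' * B').
Proof.
move=> [] -> [] ->; [by left | right | by right; rewrite mulgA | left].
  by rewrite mulgA -zC -mulgA.
by rewrite zC -mulgA (mulgA z z) zz mul1g.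
Qed.

Lemma eqz_tr A B : eqz A B -> `|tr A|%R = `|tr B|%R.
Proof. by case=> ->; rewrite ?trz ?normrN. Qed.

(** The elements of finite order. *)
Definition elliptic (A : G) := [|| (`|tr A| <= 1)%R, A == 1 | A == z].

Lemma zJ g : z ^ g = z.
Proof. by rewrite conjgE zC mulgA mulVg mul1g. Qed.

Lemma ellipticJ A g : elliptic (A ^ g) = elliptic A.
Proof. by rewrite /elliptic trJ conjg_eq1 -{1}(zJ g) (inj_eq (conjg_inj g)). Qed.

Lemma ellipticz A : elliptic (z * A) = elliptic A.
Proof.
rewrite /elliptic trz normrN; congr (_ || _).
rewrite orbC -[A == 1](inj_eq (mulgI z)) mulg1.
by rewrite -[A == z](inj_eq (mulgI z)) zz.
Qed.

Lemma eqz_elliptic A B : eqz A B -> elliptic A = elliptic B.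
Proof. by case=> ->; rewrite ?ellipticz. Qed.

(** With B = (p q; r s), the traces of B and a * B are p + s and q - r up to
sign, and p^2 + q^2 + r^2 + s^2 = (p + s)^2 + (q - r)^2 - 2 is not positive
when both are at most 1 in absolute value. *)
Lemma elliptic_a (B : G) : elliptic B -> elliptic (a * B) -> exists n, B = a ^+ n.
Proof.
have zE : z = a ^+ 2 by rewrite expg2 aa.
case/or3P=> [trB|/eqP->|/eqP->]; [|by exists 0|by exists 2; rewrite zE].
case/or3P=> [trAB|/eqP|/eqP]; last first.
- by rewrite -aa => /mulgI->; exists 1%N.
- by move/mulg1_eq <-; exists 3; sl2.
have := detSL2 B; move: trB trAB; rewrite /tr /a !mE.
move: (m11 B) (m12 B) (m21 B) (m22 B) => p q r s; nia.
Qed.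

(** The analogue for order 3, where the three traces of B, c * B and c * c * B
add up to zero. Since z = a * a, the conclusion says that B belongs to the
subgroup generated by c and z. *)
Lemma elliptic_c (B : G) : elliptic B -> elliptic (c * B) -> elliptic (c * c * B) ->
  exists i n, B = a ^+ (2 * i) * c ^+ n.
Proof.
have zE : z = a ^+ (2 * 1%N) by rewrite expg2 aa.
case/or3P=> [trB|/eqP->|/eqP->]; [|by exists 0, 0; rewrite mulg1|by exists 1%N, 0; rewrite zE mulg1].
case/or3P=> [trAB|/eqP|/eqP AB]; last first.
- by exists 1%N, 2; rewrite -zE; apply: (mulgI c); rewrite AB; sl2.
- by move/mulg1_eq <-; exists 0, 2; sl2.
case/or3P=> [trABB|/eqP|/eqP AB]; last first.
- exists 1%N, 1%N; rewrite -zE; apply: (mulgI (c * c)); rewrite AB; sl2.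
- by move/mulg1_eq <-; exists 0, 1%N; sl2.
have := detSL2 B; move: trB trAB trABB; rewrite /tr /c !mE.
move: (m11 B) (m12 B) (m21 B) (m22 B) => p q r s hx hy hw d.
pose x := (p + s)%R; pose y := (r - q - s)%R.
have hk : (-4 <= 2 * x + 4 * y <= 4)%R by rewrite /x /y; lia.
(* Complete the square in p in the equation det B = 1. *)
have hq : (3 * (q * q) + q * (2 * x + 4 * y) <= x * x - 4)%R.
  have := sqr_ge0 (2 * p - q - x)%R; rewrite expr2 => hs.
  suff : ((2 * p - q - x) * (2 * p - q - x)
           + (3 * (q * q) + q * (2 * x + 4 * y)) = x * x - 4)%R by lia.
  by rewrite -[4%R]mulr1 -[X in (_ - 4 * X)%R]d /x /y; ring.
have hxx : (x * x <= 1)%R by rewrite -expr2 -real_normK ?num_real // expr_le1.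
move: (2 * x + 4 * y)%R hk hq => k hk hq.
have hqk : (- (4 * `|q|) <= q * k)%R.
  by rewrite lerNl -mulrN (le_trans (ler_norm _)) // normrM mulrC ler_wpM2r //; lia.
have := sqr_ge0 (3 * `|q| - 2)%R.
have -> : ((3 * `|q| - 2) ^+ 2 = 9 * (q * q) - 12 * `|q| + 4)%R.
  by rewrite -[(q * q)%R]expr2 -(real_normK (num_real q)); ring.
lia.
Qed.

(** * Positive words and their traces *)

Section Words.

Variables (gT : groupType).

Definition sgn_pow (y : gT) (e : bool) := if e then y else y^-1.

(** Modulo the centre, and for s not empty, these are the cyclically reduced
words of even length in the free product of a group of order 2 and one of order 3. *)
Definition word (x y : gT) (s : seq bool) := \prod_(e <- s) (x * sgn_pow y e).

Lemma word_nil x y : word x y [::] = 1.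
Proof. exact: big_nil. Qed.

Lemma word_cons x y e s : word x y (e :: s) = x * sgn_pow y e * word x y s.
Proof. exact: big_cons. Qed.

Lemma word_cat x y s t : word x y (s ++ t) = word x y s * word x y t.
Proof. exact: big_cat. Qed.

Lemma word_rcons x y s e : word x y (rcons s e) = word x y s * (x * sgn_pow y e).
Proof. by rewrite -cats1 word_cat /word big_seq1. Qed.

End Words.

(** The elementary matrices a c and z a c^{-1}: modulo z, word a c s is
their product along s, a matrix with nonnegative entries. *)
Definition pos_letter (e : bool) : G :=
  if e then @mkSL2 1 1 0 1 erefl else @mkSL2 1 0 1 1 erefl.

Definition pos_word (s : seq bool) : G := \prod_(e <- s) pos_letter e.

Lemma pos_word_cons e s : pos_word (e :: s) = pos_letter e * pos_word s.
Proof. exact: big_cons. Qed.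

Lemma word_pos s : eqz (word a c s) (pos_word s).
Proof.
elim: s => [|e s IH]; first by rewrite word_nil /pos_word big_nil; left.
rewrite word_cons pos_word_cons; apply: eqzM IH.
by case: e; [left | right]; rewrite /sgn_pow /pos_letter; sl2.
Qed.

Lemma pos_word_ge s : [/\ 1 <= m11 (pos_word s), 0 <= m12 (pos_word s),
  0 <= m21 (pos_word s) & 1 <= m22 (pos_word s)]%R.
Proof.
elim: s => [|e s [h1 h2 h3 h4]]; first by rewrite /pos_word big_nil !mE.
by rewrite pos_word_cons; case: e; rewrite /pos_letter !mE; split; lia.
Qed.

Lemma tr_pos_word s : `|tr (pos_word s)|%R = tr (pos_word s).
Proof. by have [h1 _ _ h4] := pos_word_ge s; rewrite /tr; lia. Qed.

(** Each letter is the identity plus a nonnegative matrix, so inserting letters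
can only increase the entries. *)
Lemma pos_word_subseq s t : subseq s t ->
  [/\ m11 (pos_word s) <= m11 (pos_word t), m12 (pos_word s) <= m12 (pos_word t),
      m21 (pos_word s) <= m21 (pos_word t) & m22 (pos_word s) <= m22 (pos_word t)]%R.
Proof.
elim: t s => [|f t IH] s; first by rewrite subseq0 => /eqP->.
have [g1 g2 g3 g4] := pos_word_ge t.
have weak : subseq s t ->
  [/\ m11 (pos_word s) <= m11 (pos_word (f :: t)),
      m12 (pos_word s) <= m12 (pos_word (f :: t)),
      m21 (pos_word s) <= m21 (pos_word (f :: t))
    & m22 (pos_word s) <= m22 (pos_word (f :: t))]%R.
  move=> /IH[h1 h2 h3 h4]; rewrite (pos_word_cons f).
  by case: f; rewrite /pos_letter !mE; split; lia.
case: s weak => [|e s] weak; first by move=> _; apply/weak/sub0seq.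
rewrite /=; case: eqVneq => [->|_ //].
move=> /IH[h1 h2 h3 h4]; rewrite !pos_word_cons.
by case: f {weak}; rewrite /pos_letter !mE; split; lia.
Qed.

(** The effect on the letters of a word of replacing c by its conjugate by
word a c e while keeping a. *)
Definition stretch (e s : seq bool) :=
  flatten [seq rev (map negb e) ++ f :: e | f <- s].

(** The stretched word contains, around its first letter, two opposite letters
that come from the head of e. Already inserting these two letters increases
the trace. *)
Lemma tr_stretch e s : e != [::] -> s != [::] ->
  (tr (pos_word s) < tr (pos_word (stretch e s)))%R.
Proof.
case: e s => [//|e1 e] [//|f s] _ _.
have sub_s t : subseq t (stretch (e1 :: e) t).
  elim: t => //= g t IH; rewrite -(cat1s g t).
  apply: cat_subseq IH; apply: subseq_trans (suffix_subseq _ _).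
  by rewrite sub1seq mem_head.
have sub : subseq [:: ~~ e1, f, e1 & s] (stretch (e1 :: e) (f :: s)).
  rewrite (_ : _ :: _ = [:: ~~ e1; f; e1] ++ s) //; apply: cat_subseq (sub_s s).
  rewrite (_ : [:: _; _; _] = [:: ~~ e1] ++ [:: f; e1]) //; apply: cat_subseq.
    by rewrite sub1seq mem_rev mem_head.
  by rewrite /= !eqxx sub0seq.
have [g1 _ _ g4] := pos_word_subseq sub.
apply: (@lt_le_trans _ _ (tr (pos_word [:: ~~ e1, f, e1 & s]))); last first.
  by rewrite /tr lerD.
have [h1 h2 h3 h4] := pos_word_ge s; rewrite /tr !pos_word_cons.
by case: (e1); case: (f); rewrite /pos_letter !mE; lia.
Qed.

(** Since a^{-1} = z a, the inverse of a word reads, up to z and a shift by a, as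
the reversed word with opposite exponents. *)
Lemma word_inv_a e :
  eqz (a * (word a c e)^-1) (word a c (rev (map negb e)) * a).
Proof.
elim: e => [|f e IH]; first by rewrite /= !word_nil invg1 mulg1 mul1g; left.
have -> : a * (word a c (f :: e))^-1
    = a * (word a c e)^-1 * ((sgn_pow c f)^-1 * a^-1).
  by rewrite word_cons !invgM !mulgA.
have -> : word a c (rev (map negb (f :: e))) * a
    = word a c (rev (map negb e)) * a * (sgn_pow c (~~ f) * a).
  by rewrite /= rev_cons word_rcons !mulgA.
apply: eqzM IH _.
by case: f; right; rewrite /sgn_pow; sl2.
Qed.

Lemma word_stretch e s :
  eqz (word a (c ^ word a c e) s) (word a c (stretch e s)).
Proof.
elim: s => [|f s IH]; first by rewrite !word_nil; left.
rewrite /stretch /= word_cat word_cons; apply: eqzM IH.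
have -> : a * sgn_pow (c ^ word a c e) f
    = a * (word a c e)^-1 * (sgn_pow c f * word a c e).
  by case: f; rewrite /sgn_pow -?conjVg conjgE !mulgA.
have -> : word a c (rev (map negb e) ++ f :: e)
    = word a c (rev (map negb e)) * a * (sgn_pow c f * word a c e).
  by rewrite word_cat word_cons !mulgA.
by apply: eqzM; [apply: word_inv_a | left].
Qed.

(** * Normal forms in a quotient of the amalgam of Z/4 and Z/6 *)

Section NormalForm.

Variables (T : groupType) (x y w : T).
Hypotheses (xx : x * x = w) (yyy : y * y * y = 1) (ww : w * w = 1).
Hypothesis wC : forall g, w * g = g * w.

(** The shape of an element of the amalgam, up to a power of the central
involution. The group is kept arbitrary so that it can be a product of two copies
of SL(2, Z), where one form describes both coordinates at once. *)
Definition normal_form (g : T) := exists (i : nat) (u : T) (s : seq bool) (l : bool),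
  (u = 1 \/ exists e, u = sgn_pow y e) /\ g = w ^+ i * (u * word x y s * x ^+ l).

Lemma sgn_pow_sqr e : sgn_pow y e * sgn_pow y e = sgn_pow y (~~ e).
Proof.
have yy : y * y = y^-1 by apply/esym/mulg1_eq; rewrite mulgA.
by case: e; rewrite /= // -invgM yy invgK.
Qed.

Lemma sgn_pow_neg e : sgn_pow y e * sgn_pow y (~~ e) = 1.
Proof. by case: e; rewrite /= ?mulgV ?mulVg. Qed.

Lemma wXC i g : w ^+ i * g = g * w ^+ i.
Proof. by apply/commute_sym/commuteX/commute_sym/wC. Qed.

Lemma nf_w g : normal_form g -> normal_form (w * g).
Proof.
move=> [i [u [s [l [hu ->]]]]]; exists i.+1, u, s, l; split=> //.
by rewrite expgS !mulgA.
Qed.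

Lemma nf_y g : normal_form g -> normal_form (y * g).
Proof.
move=> [i [u [s [l [hu ->]]]]]; exists i, (y * u), s, l; split.
  case: hu => [->|[[] ->]].
  - by rewrite mulg1; right; exists true.
  - by right; exists false; rewrite (sgn_pow_sqr true).
  by left; rewrite mulgV.
by rewrite mulgA -wXC -!mulgA.
Qed.

Lemma nf_x g : normal_form g -> normal_form (x * g).
Proof.
move=> [i [u [s [l [hu ->]]]]]; case: hu => [->|[e ->]]; last first.
  exists i, 1, (e :: s), l; split; first by left.
  by rewrite word_cons !mulgA -(wXC _ x) mulg1.
have xw v : x * (x * v) = w * v by rewrite mulgA xx.
case: s => [|e s]; last first.
  rewrite mulgA -wXC -mulgA word_cons mul1g -!mulgA xw (mulgA _ w) wXC -!mulgA.
  apply: nf_w; exists i, (sgn_pow y e), s, l; split; first by right; exists e.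
  by rewrite !mulgA wXC.
rewrite word_nil !mul1g mulgA -wXC -mulgA.
case: l => /=; last first.
  by exists i, 1, [::], true; split; [left | rewrite word_nil !mul1g mulg1].
exists i.+1, 1, [::], false; split; first by left.
by rewrite word_nil expg1 xx !mul1g mulg1 expgSr.
Qed.

(** Normal forms are stable under left multiplication by the generators, by
their inverses, which are positive powers, and hence by any term. *)
Lemma gterm_normal_form (t : gterm 2) : normal_form (teval [tuple x; y] t).
Proof.
have xV : x^-1 = x * (x * x).
  by apply: mulg1_eq; rewrite xx mulgA xx ww.
have yV : y^-1 = y * y by apply: mulg1_eq; rewrite mulgA.
suff H g : normal_form g -> normal_form (teval [tuple x; y] t * g) /\
     normal_form ((teval [tuple x; y] t)^-1 * g).
  rewrite -[teval _ t]mulg1; apply: (H 1 _).1.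
  by exists 0, 1, [::], false; split; [left | rewrite word_nil !mul1g].
elim: t g => [i||t1 IH1 t2 IH2|t1 IH1] g ng /=.
- have [->|->] : tnth [tuple x; y] i = x \/ tnth [tuple x; y] i = y.
  + by case: i => [[|[|//]] lt_i]; [left | right].
  + by split; [apply: nf_x | rewrite xV -!mulgA; do 3!apply: nf_x].
  by split; [apply: nf_y | rewrite yV -!mulgA; do 2!apply: nf_y].
- by rewrite invg1 !mul1g.
- rewrite invgM -!mulgA; split; first exact: (IH1 _ (IH2 _ ng).1).1.
  exact: (IH2 _ (IH1 _ ng).2).2.
by rewrite invgK; case: (IH1 _ ng).
Qed.

(** Representatives of the conjugacy classes modulo w: the torsion elements, and
the cyclically reduced words. *)
Definition cyclic_form (r : T) := [\/ r = 1, r = x, exists e, r = sgn_pow y e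
  | exists2 s, s != [::] & r = word x y s].

Definition conj_cyclic (g : T) :=
  exists (i : nat) (h r : T), cyclic_form r /\ g = w ^+ i * r ^ h.

Lemma conj_cyclicJ g h : conj_cyclic (g ^ h) -> conj_cyclic g.
Proof.
move=> [i [k [r [cr E]]]]; exists i, (k * h^-1), r; split=> //.
have wJ : (w ^+ i) ^ h^-1 = w ^+ i by rewrite conjgE wXC mulgA mulVg mul1g.
by rewrite -[g](conjgK h) E conjMg conjgM wJ.
Qed.

Lemma conj_cyclicw g i : conj_cyclic g -> conj_cyclic (w ^+ i * g).
Proof.
move=> [j [k [r [cr ->]]]]; exists (i + j)%N, k, r; split=> //.
by rewrite expgnDr mulgA.
Qed.

Lemma cyclic_conj_cyclic g : cyclic_form g -> conj_cyclic g.
Proof. by move=> cg; exists 0, 1, g; rewrite conjg1 mul1g. Qed.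

Lemma conj_cyclicC g h : conj_cyclic (g * h) -> conj_cyclic (h * g).
Proof. by move=> H; apply: (@conj_cyclicJ _ h); rewrite conjgE !mulgA mulVg mul1g. Qed.

Lemma conj_cyclic_word s : conj_cyclic (word x y s).
Proof.
apply: cyclic_conj_cyclic; case: s => [|e s]; first by rewrite word_nil; constructor 1.
by constructor 4; exists (e :: s).
Qed.

(** Conjugating by x turns word x y s * x into a word whose two end exponents
meet: they either combine into one letter or cancel, and then the word has
become shorter by two letters. *)
Lemma conj_cyclic_word_x s : conj_cyclic (word x y s * x).
Proof.
have [n] := ubnP (size s); elim: n s => // n IH [|e s] /=.
  by move=> _; rewrite word_nil mul1g; apply: cyclic_conj_cyclic; constructor 2.
rewrite ltnS => le_s; apply: conj_cyclicC.
rewrite word_cons !mulgA xx -!mulgA -[w]expg1; apply: conj_cyclicw.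
apply: conj_cyclicC; case/lastP: s le_s => [|s f].
  by move=> _; rewrite word_nil mul1g; apply: cyclic_conj_cyclic; constructor 3; exists e.
rewrite size_rcons word_rcons -!mulgA => le_s.
have [->|ne] := eqVneq f e.
  by rewrite sgn_pow_sqr -word_rcons; apply: conj_cyclic_word.
have -> : e = ~~ f by case: (f) (e) ne => [] [].
by rewrite sgn_pow_neg mulg1; apply: IH; lia.
Qed.

Lemma conj_cyclic_word_y s e : conj_cyclic (word x y s * sgn_pow y e).
Proof.
case/lastP: s => [|s f].
  by rewrite word_nil mul1g; apply: cyclic_conj_cyclic; constructor 3; exists e.
rewrite word_rcons -!mulgA; have [->|ne] := eqVneq f e.
  by rewrite sgn_pow_sqr -word_rcons; apply: conj_cyclic_word.
have -> : e = ~~ f by case: (f) (e) ne => [] [].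
by rewrite sgn_pow_neg mulg1; apply: conj_cyclic_word_x.
Qed.

(** Conjugation brings the first syllable of the normal form to its end, where it
meets the last one. *)
Lemma gterm_conj_cyclic (t : gterm 2) : conj_cyclic (teval [tuple x; y] t).
Proof.
have [i [u [s [l [hu ->]]]]] := gterm_normal_form t.
apply: conj_cyclicw; rewrite -mulgA; apply: conj_cyclicC.
case: hu l => [->|[e ->]] [] /=; rewrite ?mulg1.
- exact: conj_cyclic_word_x.
- exact: conj_cyclic_word.
- by rewrite -mulgA -word_rcons; apply: conj_cyclic_word.
exact: conj_cyclic_word_y.
Qed.

End NormalForm.

(** * Automorphisms *)

(** The condition on traces lets an automorphism be undone without changing the
quantity that is compared. *)
Definition trace_aut (f : G -> G) := [/\ {morph f : A B / A * B}, bijective f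
  & forall A, `|tr (f A)|%R = `|tr A|%R].

Lemma trace_aut_id : trace_aut id.
Proof. by split=> //; exists id. Qed.

Lemma trace_aut_comp f g : trace_aut f -> trace_aut g -> trace_aut (f \o g).
Proof.
move=> [fM fB ft] [gM gB gt]; split; last by move=> A; rewrite /= ft gt.
  by move=> A B; rewrite /= gM fM.
exact: bij_comp.
Qed.

Lemma trace_aut_conj h : trace_aut (conjg^~ h).
Proof.
split=> [A B||A]; [exact: conjMg | | by rewrite trJ].
by exists (conjg^~ h^-1); [apply: conjgK | apply: conjgKV].
Qed.

Fact swap_subproof (A : G) : (m22 A * m11 A - m21 A * m12 A = 1)%R.
Proof. by rewrite -(detSL2 A); ring. Qed.

(** Conjugation by the permutation matrix of determinant -1, an outer
automorphism that inverts both a and c. *)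
Definition swap (A : G) : G := mkSL2 (swap_subproof A).

Lemma trace_aut_swap : trace_aut swap.
Proof.
split=> [A B||A]; last by rewrite /tr !mE addrC.
  by apply: SL2P; rewrite /swap !mE; ring.
by exists swap => A; apply: SL2P; rewrite /swap !mE.
Qed.

(** The reduction of A modulo 2 is an odd permutation of the three nonzero
vectors of the plane over the field with two elements. *)
Definition odd_mod2 (A : G) : bool :=
  (odd `|m11 A| == odd `|m22 A|) && (odd `|m12 A| || odd `|m21 A|).

Lemma odd_absz_sub (m n : nat) : odd `|(m%:Z - n%:Z)%R| = odd m (+) odd n.
Proof.
wlog le_nm : m n / (n <= m)%N; last by rewrite distnEl // oddB.
by move=> W; case/orP: (leq_total n m) => /W // ; rewrite distnC addbC.
Qed.

Lemma odd_abszD (m n : int) : odd `|(m + n)%R| = odd `|m| (+) odd `|n|.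
Proof.
case: m n => m [] n; rewrite ?NegzE.
- by rewrite -PoszD oddD.
- by rewrite odd_absz_sub abszN.
- by rewrite addrC odd_absz_sub abszN addbC.
by rewrite -opprD !abszN -PoszD oddD.
Qed.

Lemma odd_mod2M A B : odd_mod2 (A * B) = odd_mod2 A (+) odd_mod2 B.
Proof.
have dA := congr1 (fun n => odd `|n|%N) (detSL2 A).
have dB := congr1 (fun n => odd `|n|%N) (detSL2 B).
have oB (m n : int) : odd `|(m - n)%R| = odd `|m| (+) odd `|n|.
  by rewrite odd_abszD abszN.
have oM (m n : int) : odd `|(m * n)%R| = odd `|m| && odd `|n| by rewrite abszM oddM.
move: dA dB; rewrite /odd_mod2 !mM /= !oB !odd_abszD !oM.
by do 8!case: (odd _).
Qed.

(** Multiplication by the sign character of the reduction modulo 2: it inverts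
a, which is odd, and fixes c, which is even. *)
Definition twist (A : G) : G := if odd_mod2 A then z * A else A.

Lemma odd_mod2_z : odd_mod2 z = false.
Proof. by rewrite /odd_mod2 /z !mE. Qed.

Lemma trace_aut_twist : trace_aut twist.
Proof.
split=> [A B||A]; last by rewrite /twist; case: ifP; rewrite // trz normrN.
  have E : twist (A * B) = (if odd_mod2 A (+) odd_mod2 B then z else 1) * (A * B).
    by rewrite /twist odd_mod2M; case: ifP; rewrite ?mul1g.
  rewrite E /twist; case: (odd_mod2 A); case: (odd_mod2 B) => /=; rewrite ?mul1g ?mulgA //.
    by rewrite (zC A) -(mulgA A z z) zz mulg1.
  by rewrite (zC A).
suff twistK : involutive twist by exists twist.
move=> A; rewrite /twist; case oA: (odd_mod2 A); rewrite ?odd_mod2M ?odd_mod2_z oA //.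
by rewrite /= mulgA zz mul1g.
Qed.

Lemma trace_aut_sgn e1 e2 : exists f,
  [/\ trace_aut f, f a = sgn_pow a e1 & f c = sgn_pow c e2].
Proof.
have ta : twist a = a^-1 by rewrite /twist /odd_mod2 {1 2 3 4}/a !mE; sl2.
have tc : twist c = c by rewrite /twist /odd_mod2 {1 2 3 4}/c !mE.
have sa : swap a = a^-1 by rewrite /swap; sl2.
have sc : swap c = c^-1 by rewrite /swap; sl2.
have taV : twist a^-1 = a.
  by rewrite /twist /odd_mod2 {1 2 3 4}/a !mE; sl2.
have tcV : twist c^-1 = c^-1 by rewrite /twist /odd_mod2 {1 2 3 4}/c !mE.
case: e1 e2 => [] [].
- by exists id; split=> //; apply: trace_aut_id.
- exists (twist \o swap); rewrite /= sa sc taV tcV; split=> //.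
  by apply: trace_aut_comp; [apply: trace_aut_twist | apply: trace_aut_swap].
- by exists twist; split=> //; apply: trace_aut_twist.
by exists swap; split=> //; apply: trace_aut_swap.
Qed.

Lemma sq_eq1 (A : G) : A * A = 1 -> A = 1 \/ A = z.
Proof.
move=> AA; have E : A = A^-1 by apply/esym/mulg1_eq.
have e11 : m11 A = m22 A by rewrite {1}E mE.
have e12 : m12 A = 0%R by have : m12 A = (- m12 A)%R by [rewrite {1}E mE]; lia.
have e21 : m21 A = 0%R by have : m21 A = (- m21 A)%R by [rewrite {1}E mE]; lia.
have := detSL2 A; rewrite e12 -e11 mul0r subr0 => /intUnitRing.unitzPl/orP[]/eqP e.
  by left; apply: SL2P; rewrite !mE -?e11.
by right; apply: SL2P; rewrite /z !mE -?e11.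
Qed.

(** A square root of the unique involution z has trace 0. *)
Lemma order4_conj (x : G) : x * x * x * x = 1 -> x * x != 1 ->
  x * x = z /\ exists e h, x = sgn_pow a e ^ h.
Proof.
move=> x4 x2; have xx : x * x = z.
  have [/eqP|//] : x * x = 1 \/ x * x = z by apply: sq_eq1; rewrite !mulgA.
  by rewrite (negPf x2).
split=> //; have E : x^-1 = z * x.
  by apply: mulg1_eq; rewrite mulgA -zC -mulgA xx zz.
have /conj_a[g xg] : tr x = 0%R.
  by have := congr1 m11 E; rewrite /tr /z !mE; lia.
by case: xg => xg; [exists true | exists false]; exists g^-1; rewrite /= -xg conjgK.
Qed.

(** By Cayley-Hamilton an element of order 3 has trace -1. *)
Lemma order3_conj (y : G) : y * y * y = 1 -> y != 1 -> exists e h, y = sgn_pow c e ^ h.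
Proof.
move=> y3 y1; have E : y^-1 = y * y by apply: mulg1_eq; rewrite mulgA.
suff /conj_c[g yg] : tr y = (-1)%R.
  case: yg => yg; [exists true | exists false]; exists g^-1;
  by rewrite /= -yg conjgK.
have := detSL2 y; have := congr1 m11 E; have := congr1 m12 E.
have := congr1 m21 E; have := congr1 m22 E; rewrite /tr !mE => h22 h21 h12 h11 d.
have t12 : (m12 y * (m11 y + m22 y + 1) = 0)%R by lia.
have t21 : (m21 y * (m11 y + m22 y + 1) = 0)%R by lia.
have [//|ne] := eqVneq (m11 y + m22 y)%R (-1)%R.
have ne0 : (m11 y + m22 y + 1)%R != 0%R by lia.
move/eqP: t12; rewrite mulf_eq0 (negPf ne0) orbF => /eqP e12.
move/eqP: t21; rewrite mulf_eq0 (negPf ne0) orbF => /eqP e21.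
rewrite e12 e21 mulr0 !(addr0, add0r, subr0) in h11 h22 d.
case/negP: y1; apply/eqP.
have p1 : m11 y = 1%R.
  have := d; rewrite mulrC => /intUnitRing.unitzPl/orP[]/eqP e //.
  by rewrite e in h11 d; lia.
by apply: SL2P; rewrite !mE // h11 p1 mulr1.
Qed.

(** * Terms and existential formulas *)

Lemma morph1 (H K : groupType) (f : H -> K) :
  {morph f : x y / x * y} -> f 1 = 1.
Proof. by move=> fM; apply: (mulgI (f 1)); rewrite -fM !mulg1. Qed.

Lemma morphV (H K : groupType) (f : H -> K) :
  {morph f : x y / x * y} -> {morph f : x / x^-1}.
Proof. by move=> fM x; apply/esym/mulg1_eq; rewrite -fM mulgV morph1. Qed.

Lemma teval_morph (H K : groupType) (f : H -> K) (k : nat) (e : k.-tuple H) t :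
  {morph f : x y / x * y} -> teval (map_tuple f e) t = f (teval e t).
Proof.
move=> fM; elim: t => [i||t1 IH1 t2 IH2|t IH] /=; first exact: tnth_map.
- by rewrite morph1.
- by rewrite IH1 IH2 fM.
by rewrite IH morphV.
Qed.

Lemma morphX (H K : groupType) (f : H -> K) :
  {morph f : x y / x * y} -> forall n, {morph f : x / x ^+ n}.
Proof.
by move=> fM; elim=> [|n IH] x; rewrite ?expg0 ?morph1 // !expgS fM IH.
Qed.

Fixpoint tsubst (k m : nat) (s : 'I_k -> gterm m) (t : gterm k) : gterm m :=
  match t with
  | TVar i => s i
  | TOne => TOne
  | TMul t1 t2 => TMul (tsubst s t1) (tsubst s t2)
  | TInv t1 => TInv (tsubst s t1)
  end.

Lemma teval_subst (H : groupType) (k m : nat) (s : 'I_k -> gterm m) (e : m.-tuple H)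
    (d : k.-tuple H) t :
  (forall i, tnth d i = teval e (s i)) -> teval e (tsubst s t) = teval d t.
Proof. by move=> E; elim: t => //= [t1 -> t2 ->|t ->]. Qed.

Section Transfer.

Variables (H : groupType) (k : nat).

Definition conjunction (n : nat) (phis : seq (gformula n)) : gformula n :=
  foldr (fun phi psi => FAnd phi psi) (FEq TOne TOne) phis.

Lemma conjunctionP n (I : eqType) (s : seq I) (F : I -> gformula n) (e : n.-tuple H) :
  satisfies (conjunction [seq F i | i <- s]) e <-> (forall i, i \in s -> satisfies (F i) e).
Proof.
elim: s => [|i s IH] /=; first by split.
rewrite IH; split=> [[h hs] j|h]; first by rewrite in_cons => /predU1P[->|/hs].
by split=> [|j js]; apply: h; rewrite in_cons ?eqxx ?js ?orbT.
Qed.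

(* The outer quantifier binds x, so it has index 1 in the body. *)
Definition var_y : gterm k.+2 := TVar ord0.
Definition var_x : gterm k.+2 := TVar (lift ord0 ord0).

(** The coordinates are given by the terms t in a pair (x, y) satisfying the
relations of (a, c) together with the inequations that prevent x and y from
degenerating. *)
Definition pair_formula (t : 'I_k -> gterm 2) : gformula k :=
  let xy := fun i : 'I_2 => if i == 0 :> nat then var_x else var_y in
  FEx (FEx (FAnd
    (FAnd (FAnd (FEq (TMul (TMul (TMul var_x var_x) var_x) var_x) TOne)
                (FNot (FEq (TMul var_x var_x) TOne)))
          (FAnd (FEq (TMul (TMul var_y var_y) var_y) TOne)
                (FNot (FEq var_y TOne))))
    (conjunction [seq FEq (TVar (lift ord0 (lift ord0 i))) (tsubst xy (t i))
                  | i <- enum 'I_k]))).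

Lemma pair_formula_existential t : existential (pair_formula t).
Proof.
by rewrite /=; elim: (enum _).
Qed.

Lemma pair_formulaP t (u : k.-tuple H) :
  satisfies (pair_formula t) u <->
  exists x y, [/\ x * x * x * x = 1, x * x <> 1, y * y * y = 1, y <> 1
    & forall i, tnth u i = teval [tuple x; y] (t i)].
Proof.
have E x y i : satisfies (FEq (TVar (lift ord0 (lift ord0 i)))
     (tsubst (fun i : 'I_2 => if i == 0 :> nat then var_x else var_y) (t i)))
     [tuple of y :: [tuple of x :: u]] <-> tnth u i = teval [tuple x; y] (t i).
  rewrite /= (@teval_subst _ _ _ _ _ [tuple x; y]); first by rewrite !tnthS.
  by case=> [[|[|//]] lt_i].
rewrite /pair_formula /=; split=> [[x [y [[[h1 h2] [h3 h4]] /conjunctionP h]]]|].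
  exists x, y; split=> // i; apply/E; apply: h; exact: mem_enum.
move=> [x [y [h1 h2 h3 h4 h]]]; exists x, y; split; first by split; split.
by apply/conjunctionP=> i _; apply/E.
Qed.

End Transfer.

(** * Copies of the generators inside the group *)

Lemma existential_transfer k (u v : k.-tuple G) (t : 'I_k -> gterm 2) :
  same_existential_type u v -> (forall i, tnth u i = teval [tuple a; c] (t i)) ->
  exists x y, [/\ x * x * x * x = 1, x * x <> 1, y * y * y = 1, y <> 1
    & forall i, tnth v i = teval [tuple x; y] (t i)].
Proof.
move=> uv ut; apply/(pair_formulaP t)/uv; first exact: pair_formula_existential.
apply/pair_formulaP; exists a, c; split=> //; try by sl2.
  by move/(congr1 m11); rewrite aa /z !mE.
by move/(congr1 m11); rewrite /c !mE.
Qed.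

Lemma conjg_fix_prefix (H : groupType) (g p q r s : H) : g ^ p = g -> g ^ q = g ->
  g ^ (p * (q * r * s)) = (g ^ r) ^ s.
Proof. by move=> gp gq; rewrite !conjgM gp gq. Qed.

(** Both x and y are conjugate to a and c up to inversion; an automorphism brings x to
a, and the conjugator of y is simplified by its normal form, whose first part
commutes with c and whose last part commutes with a. *)
Lemma generating_pair_standard (x y : G) :
  x * x * x * x = 1 -> x * x <> 1 -> y * y * y = 1 -> y <> 1 ->
  exists f s, [/\ trace_aut f, x = f a & y = f (c ^ word a c s)].
Proof.
move=> x4 /eqP x2 y3 /eqP y1.
have [xx [e1 [h1 ->]]] := order4_conj x4 x2; have [e2 [h2 ->]] := order3_conj y3 y1.
have [f [fA <- <-]] := trace_aut_sgn e1 e2.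
have [fM [f' fK f'K] _] := fA.
have fJ A B : f (A ^ B) = f A ^ f B by rewrite !conjgE !fM (morphV fM).
pose g := f' (h2 * h1^-1); have fg : f g = h2 * h1^-1 by exact: f'K.
have [t gt] := gen_ac g.
have [i [w [s [l [hw E]]]]] := gterm_normal_form aa ccc zz zC t.
have cg : c ^ g = (c ^ word a c s) ^ (a ^+ l).
  have cz : c ^ (z ^+ i) = c by rewrite conjgE -(wXC zC) mulKg.
  have cw : c ^ w = c.
    case: hw => [->|[[] ->]] /=; first exact: conjg1; first by rewrite conjgE mulKg.
    by rewrite conjgE invgK mulgV mulg1.
  by rewrite gt E (conjg_fix_prefix _ _ cz cw).
have al : a ^ (a ^+ l) = a by case: (l); [rewrite expg1 conjgE mulKg | apply: conjg1].
exists (conjg^~ h1 \o f \o conjg^~ (a ^+ l)), s; split=> /=.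
- exact: trace_aut_comp (trace_aut_comp (trace_aut_conj _) fA) (trace_aut_conj _).
- by rewrite al.
by rewrite -cg fJ fg -conjgM mulgVK.
Qed.

Lemma eqzX i A : eqz (z ^+ i * A) A.
Proof.
elim: i => [|i IH]; first by rewrite mul1g; left.
by rewrite expgS -mulgA; apply: eqz_trans IH; right.
Qed.

Lemma stretch_nil s : stretch [::] s = s.
Proof. by rewrite /stretch; elim: s => //= f s ->. Qed.

Lemma tr_gt2_not_elliptic A : (2 < `|tr A|)%R -> ~~ elliptic A.
Proof.
move=> h; rewrite /elliptic negb_or negb_or; apply/and3P; split; first by lia.
  by apply/eqP=> E; move: h; rewrite E /tr !mE.
by apply/eqP=> E; move: h; rewrite E /tr /z !mE.
Qed.

(** The pair of values of t at (a, c) and at (x, y) is a single element of the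
product of two copies of the group. Conjugating it there to a cyclic form shows
both values simultaneously as the same word in a, c and in x, y. *)
Lemma tr_stretch_teval x y f s (t : gterm 2) :
  x * x = z -> y * y * y = 1 -> trace_aut f -> x = f a -> y = f (c ^ word a c s) ->
  ~~ elliptic (teval [tuple a; c] t) ->
  (`|tr (teval [tuple a; c] t)| <= `|tr (teval [tuple x; y] t)| ?= iff (s == [::]))%R.
Proof.
move=> xx y3 [fM _ ftr] fx fy.
pose X : (G * G)%type := (a, x); pose Y : (G * G)%type := (c, y).
pose W : (G * G)%type := (z, z).
have e1 : teval [tuple a; c] t = (teval [tuple X; Y] t).1.
  rewrite -(teval_morph (f := fst)) //; congr teval; exact: val_inj.
have e2 : teval [tuple x; y] t = (teval [tuple X; Y] t).2.
  rewrite -(teval_morph (f := snd)) //; congr teval; exact: val_inj.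
have XX : X * X = W by congr (_, _); rewrite ?aa.
have Y3 : Y * Y * Y = 1 by congr (_, _); rewrite ?ccc.
have WW : W * W = 1 by congr (_, _); rewrite ?zz.
have WC g : W * g = g * W by case: g => g1 g2; congr (_, _); apply: zC.
have [i [h [r [cr E]]]] := gterm_conj_cyclic XX Y3 WW WC t.
have X1 n : (W ^+ n).1 = z ^+ n.
  by elim: n => // n IH; rewrite !expgS -IH.
have X2 n : (W ^+ n).2 = z ^+ n.
  by elim: n => // n IH; rewrite !expgS -IH.
have {}e1 : teval [tuple a; c] t = z ^+ i * r.1 ^ h.1 by rewrite e1 E -X1.
have {}e2 : teval [tuple x; y] t = z ^+ i * r.2 ^ h.2 by rewrite e2 E -X2.
rewrite e1 e2 (eqz_elliptic (eqzX _ _)) ellipticJ !(eqz_tr (eqzX _ _)) !trJ => nell.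
case: cr nell => [->|->|[e ->]|[w w0 ->]].
- by rewrite /elliptic eqxx orbT.
- by rewrite /elliptic /tr /a !mE.
- by case: e; rewrite /elliptic /tr /c /= !mE.
have -> : (word X Y w).1 = word a c w.
  by elim: (w) => [|[] w' IH]; rewrite ?word_nil // !word_cons -IH.
have -> : (word X Y w).2 = f (word a (c ^ word a c s) w).
  elim: (w) => [|e w' IH]; first by rewrite !word_nil (morph1 fM).
  rewrite !word_cons !fM -IH -fx.
  by congr (_ * _ * _); case: (e); rewrite /= ?(morphV fM) -fy.
move=> _; rewrite ftr (eqz_tr (word_stretch _ _)) !(eqz_tr (word_pos _)) !tr_pos_word.
have [->|s0] := eqVneq s [::]; first by rewrite stretch_nil; apply/leif_refl.
have lt := tr_stretch s0 w0.
by split; [apply: ltW | apply: lt_eqF].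
Qed.

(** A family generating a torsion subgroup is conjugate into <a> or into <c, z>:
once a noncentral member has been conjugated to a generator, its products with
another member bound the traces that locate the latter. *)
Lemma elliptic_family (I : finType) (u : I -> G) :
  (forall i j, [&& elliptic (u i), elliptic (u i * u j) & elliptic (u i * u i * u j)]) ->
  exists g, (forall i, exists n, u i ^ g = a ^+ n) \/
            (forall i, exists m n, u i ^ g = a ^+ (2 * m) * c ^+ n).
Proof.
move=> ell_u; have zE : z = a ^+ 2 by rewrite expg2 aa.
have [/existsP[i]|/existsPn central] :=
  boolP [exists i, (u i != 1) && (u i != z)]; last first.
  exists 1; left=> i; rewrite conjg1; have := central i.
  by rewrite negb_and !negbK => /orP[]/eqP->; [exists 0 | exists 2].
case/andP=> ui1 uiz; have /and3P[ell_i _ _] := ell_u i i.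
have conj_ell g j : [/\ elliptic (u j ^ g), elliptic (u i ^ g * u j ^ g)
     & elliptic (u i ^ g * u i ^ g * u j ^ g)].
  by rewrite -!conjMg !ellipticJ; have /and3P[_ -> ->] := ell_u i j; have /and3P[-> _ _] := ell_u j i.
have cV : c^-1 = c * c by apply: mulg1_eq; rewrite mulgA ccc.
have ccV : c^-1 * c^-1 = c by sl2.
have c_case g : eqz (u i ^ g) c \/ eqz (u i ^ g) c^-1 ->
    forall j, exists m n, u j ^ g = a ^+ (2 * m) * c ^+ n.
  move=> hg j; have [h1 h2 h3] := conj_ell g j.
  apply: elliptic_c => //; case: hg => hg.
  - by rewrite -(eqz_elliptic (eqzM hg (eqz_refl _))).
  - move: h3; rewrite (eqz_elliptic (eqzM (eqzM hg hg) (eqz_refl _))).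
    by rewrite ccV.
  - by rewrite -(eqz_elliptic (eqzM (eqzM hg hg) (eqz_refl _))).
  by rewrite -cV -(eqz_elliptic (eqzM hg (eqz_refl _))).
move: ell_i; rewrite /elliptic (negPf ui1) (negPf uiz) !orbF => tri.
have [tr0|[tr1|trN1]] : tr (u i) = 0%R \/ tr (u i) = 1%R \/ tr (u i) = (-1)%R by lia.
- have [g hg] := conj_a tr0; exists g; left=> j.
  have [h1 h2 _] := conj_ell g j; apply: elliptic_a => //.
  case: hg => hg; first by rewrite -hg.
  have zaV : z * a = a^-1 by sl2.
  by rewrite -ellipticz mulgA zaV -hg.
- have [|g hg] := @conj_c (z * u i); first by rewrite trz tr1.
  exists g; right; apply: c_case; move: hg; rewrite conjMg zJ.
  by case=> <-; [left | right]; right; rewrite mulgA zz mul1g.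
have [g hg] := conj_c trN1; exists g; right; apply: c_case.
by case: hg => ->; [left | right]; left.
Qed.

(** Either some term has values of infinite order on u, and the two opposite
trace inequalities force the substitution to be an automorphism; or u generates
a finite group, and it is written by terms on which any pair (x, y) agrees with
an automorphism. *)
Lemma existential_type_trace_aut k (u v : k.-tuple G) : same_existential_type u v ->
  exists2 f, trace_aut f & forall i, tnth v i = f (tnth u i).
Proof.
move=> uv.
have [nell|ell_u] : (exists t, ~~ elliptic (teval u t)) \/ (forall i j, [&& elliptic (tnth u i),
    elliptic (tnth u i * tnth u j) & elliptic (tnth u i * tnth u i * tnth u j)]).
  have [/'forall_forallP|] := boolP [forall i, forall j, [&& elliptic (tnth u i),
    elliptic (tnth u i * tnth u j) & elliptic (tnth u i * tnth u i * tnth u j)]]; first by right.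
  rewrite negb_forall => /existsP[i]; rewrite negb_forall => /existsP[j].
  rewrite !negb_and => /or3P[] nell; left.
  - by exists (TVar i).
  - by exists (TMul (TVar i) (TVar j)).
  by exists (TMul (TMul (TVar i) (TVar i)) (TVar j)).
(* The traces of W at u and at v bound each other. *)
- have [W Wu] := nell.
  have [t ut] := fin_all_exists (fun i => gen_ac (tnth u i)).
  have [t' vt'] := fin_all_exists (fun i => gen_ac (tnth v i)).
  have [x [y [x4 x2 y3 y1 vt]]] := existential_transfer uv ut.
  have vu : same_existential_type v u by move=> phi hphi; rewrite (uv phi hphi).
  have [x' [y' [x4' x2' y3' y1' ut']]] := existential_transfer vu vt'.
  have [f [s [fA fx fy]]] := generating_pair_standard x4 x2 y3 y1.
  have [f' [s' [fA' fx' fy']]] := generating_pair_standard x4' x2' y3' y1'.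
  have [xx _] := order4_conj x4 (introN eqP x2).
  have [xx' _] := order4_conj x4' (introN eqP x2').
  have le t0 := tr_stretch_teval (t := tsubst t t0) xx y3 fA fx fy.
  have le' t0 := tr_stretch_teval (t := tsubst t' t0) xx' y3' fA' fx' fy'.
  have {}le : (~~ elliptic (teval u W) ->
      `|tr (teval u W)| <= `|tr (teval v W)| ?= iff (s == [::]))%R.
    by have := le W; rewrite !(teval_subst _ ut) !(teval_subst _ vt).
  have {}le' : (~~ elliptic (teval v W) ->
      `|tr (teval v W)| <= `|tr (teval u W)| ?= iff (s' == [::]))%R.
    by have := le' W; rewrite !(teval_subst _ ut') !(teval_subst _ vt').
  (* If s were not empty the first bound would be strict, so the value of W at
     v would also have infinite order and the second bound would apply. *)
  have s0 : s = [::].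
    apply/eqP; case: (le Wu) => leW <-; rewrite eq_le leW /=.
    have [//|lt] := leP `|tr (teval v W)|%R `|tr (teval u W)|%R.
    have Wv : ~~ elliptic (teval v W).
      apply: tr_gt2_not_elliptic; move: lt; move: Wu; rewrite /elliptic !negb_or => /and3P[]; lia.
    by case: (le' Wv) => /(lt_le_trans lt); rewrite ltxx.
  exists f => // i; rewrite vt ut -(teval_morph (f := f)); last by case: fA.
  by congr teval; apply: val_inj; rewrite /= fx fy s0 word_nil conjg1.
(* The conjugator is itself a term in a and c, whose value at (x, y) is an
   arbitrary element D: this is harmless, since conjugation by D is inner. *)
have [g hg] := elliptic_family ell_u.
have [t0 gt0] := gen_ac g^-1.
pose tpow (t : gterm 2) n := iter n (TMul t) TOne.
have tpowE (e : 2.-tuple G) t n : teval e (tpow t n) = teval e t ^+ n.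
  by elim: n => //= n ->; rewrite expgS.
pose tconj (t : gterm 2) := TMul (TInv t0) (TMul t t0).
pose ta : gterm 2 := TVar ord0; pose tc : gterm 2 := TVar (lift ord0 ord0).
case: hg => hg.
- have [n hn] := fin_all_exists hg.
  have [|x [y [x4 x2 y3 y1 vt]]] := existential_transfer (t := fun i : 'I_k => tconj (tpow ta (n i))) uv.
    by move=> i; rewrite /= tpowE -gt0 -conjgE /= -hn conjgK.
  have [f [s [fA fx _]]] := generating_pair_standard x4 x2 y3 y1.
  set D := teval [tuple x; y] t0 in vt *.
  exists (conjg^~ D \o f \o conjg^~ g).
    exact: trace_aut_comp (trace_aut_comp (trace_aut_conj _) fA) (trace_aut_conj _).
  move=> i; rewrite vt /= hn tpowE -/D -conjgE; congr (_ ^ _).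
  by have [fM _ _] := fA; rewrite (morphX fM) -fx.
have {}hg i : exists mn, tnth u i ^ g = a ^+ (2 * mn.1) * c ^+ mn.2.
  by have [m [n hmn]] := hg i; exists (m, n).
have [mn hmn] := fin_all_exists hg.
have [|x [y [x4 x2 y3 y1 vt]]] := existential_transfer
    (t := fun i : 'I_k => tconj (TMul (tpow ta (2 * (mn i).1)%N) (tpow tc (mn i).2))) uv.
  by move=> i; rewrite /= !tpowE -gt0 -conjgE /= -hmn conjgK.
have [f [s [fA fx fy]]] := generating_pair_standard x4 x2 y3 y1.
set D := teval [tuple x; y] t0 in vt *.
exists (conjg^~ D \o f \o conjg^~ (word a c s) \o conjg^~ g).
  apply: trace_aut_comp (trace_aut_conj _).
  exact: trace_aut_comp (trace_aut_comp (trace_aut_conj _) fA) (trace_aut_conj _).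
move=> i; rewrite vt /= hmn !tpowE -/D -conjgE; congr (_ ^ _).
have [fM _ _] := fA; rewrite conjMg.
(* The even powers of a are central, so f composed with the conjugation by
   word a c s agrees with the substitution on both factors. *)
have -> : (a ^+ (2 * (mn i).1)) ^ word a c s = a ^+ (2 * (mn i).1).
  by rewrite expgnA expg2 aa conjXg zJ.
by rewrite conjXg fM !(morphX fM) /= -fx -fy.
Qed.

Theorem mainTheorem7 (k : nat) (k_ge1 : (1 <= k)%N) (u v : k.-tuple (SL 2 int))
    (uv : same_existential_type u v) :
  exists sigma : {multiplicative SL 2 int -> SL 2 int},
    bijective sigma /\ map_tuple sigma u = v.
Proof.
have [f [fM fB _] vf] := existential_type_trace_aut uv.
pose fmul := isMultiplicative.Build G G f fM.
pose sigma : {multiplicative G -> G} := HB.pack f fmul.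
exists sigma; split; first exact: fB.
by apply: eq_from_tnth => i; rewrite tnth_map vf.
Qed.
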